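(* Assume the Continuum Hypothesis (CH). Then there is a strongly $\aleph_0$-separated almost disjoint family $\mathcal{A}$ which is not almost-normal, i.e., such that the space $\Psi(\mathcal{A})$ is not almost-normal.
   Context: An almost disjoint (AD) family is a family $\mathcal{A}$ of infinite subsets of $\omega$ such that $A\cap B$ is finite for all distinct $A,B\in\mathcal{A}$. Write $X\subseteq^*Y$ if $X\setminus Y$ is finite. An infinite set $D\subseteq\omega$ is a partitioner for an AD family $\mathcal{A}$ if for every $A\in\mathcal{A}$ either $A\subseteq^*D$ or $A\cap D$ is finite. An AD family $\mathcal{A}$ is strongly $\aleph_0$-separated if for every two disjoint countable subfamilies $\mathcal{B},\mathcal{C}\subseteq\mathcal{A}$ there is a partitioner $D$ for $\mathcal{A}$ such that $B\subseteq^*D$ for every $B\in\mathcal{B}$ and $C\cap D$ is finite for every $C\in\mathcal{C}$. The $\Psi$-space (Mrówka-Isbell space) $\Psi(\mathcal{A})$ of an AD family $\mathcal{A}$ has underlying set $\omega\cup\mathcal{A}$ (disjoint union); points of $\omega$ are isolated, and the basic neighborhoods of $A\in\mathcal{A}$ are the sets $\{A\}\cup(A\setminus F)$ with $F\subseteq\omega$ finite. An AD family $\mathcal{A}$ is said to satisfy a topological property iff $\Psi(\mathcal{A})$ does. A subset $C$ of a space $X$ is regular closed if $C=\overline{\mathrm{int}(C)}$. A space $X$ is almost-normal if for every two disjoint closed sets $C,D\subseteq X$, one of which is regular closed, there are disjoint open sets $U,V\subseteq X$ with $C\subseteq U$ and $D\subseteq V$. *)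

(* Defs.v *)
From HB Require Import structures.
From mathcomp Require Import all_boot.
From mathcomp Require Import boolp classical_sets functions cardinality filter.
From mathcomp Require Import topology.

Set Implicit Arguments.
Unset Strict Implicit.
Unset Printing Implicit Defensive.

Local Open Scope classical_set_scope.
Local Open Scope card_scope.

Definition CH : Prop :=
  forall S : set (set nat), countable S \/ S #= [set: set nat].

Definition almost_subset (X Y : set nat) : Prop := finite_set (X `\` Y).

Notation "X `<=*` Y" := (almost_subset X Y)
  (at level 70, no associativity) : classical_set_scope.

Definition almost_disjoint_family (A : set (set nat)) : Prop :=
  (forall a, A a -> infinite_set a) /\
  (forall a b, A a -> A b -> a <> b -> finite_set (a `&` b)).

Definition partitioner (A : set (set nat)) (D : set nat) : Prop :=
  infinite_set D /\ forall a, A a -> a `<=*` D \/ finite_set (a `&` D).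

(* [countable] means at most countable, so [B] and [C] may be finite. *)
Definition strongly_aleph0_separated (A : set (set nat)) : Prop :=
  forall B C : set (set nat),
    B `<=` A -> C `<=` A -> countable B -> countable C -> B `&` C = set0 ->
    exists D : set nat,
      [/\ partitioner A D,
          forall b, B b -> b `<=*` D &
          forall c, C c -> finite_set (c `&` D)].

(* The [Definition] hides the sum type, so that the disjoint-sum topology
   is not inferred on the underlying set. *)
Definition Psi (A : set (set nat)) : Type := (nat + A)%type.

Section PsiTopology.
Variable A : set (set nat).

Definition Psi_nat (n : nat) : Psi A := inl n.
Definition Psi_mem (a : A) : Psi A := inr a.

HB.instance Definition _ := gen_eqMixin (Psi A).
HB.instance Definition _ := gen_choiceMixin (Psi A).

Definition Psi_basic (p : Psi A) (F : set nat) : set (Psi A) :=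
  match p with
  | inl n => [set Psi_nat n]
  | inr a => [set Psi_mem a] `|` Psi_nat @` (val a `\` F)
  end.

Definition Psi_nbhs (p : Psi A) : set_system (Psi A) :=
  filter_from finite_set (Psi_basic p).

Lemma Psi_basic_refl p F : Psi_basic p F p.
Proof. by case: p => [n|a] //=; left. Qed.

Lemma Psi_nbhs_filter p : ProperFilter (Psi_nbhs p).
Proof.
apply: filter_from_proper; last by move=> F _; exists p; exact: Psi_basic_refl.
apply: filter_from_filter; first by exists set0; exact: finite_set0.
move=> F G finF finG; exists (F `|` G); first by rewrite finite_setU.
case: p => [n|a] //= q [->|[n [an /not_orP[nF nG]] <-]].
  by split; left.
by split; right; exists n.
Qed.

Lemma Psi_nbhs_singleton p U : Psi_nbhs p U -> U p.
Proof. by case=> F _; apply; exact: Psi_basic_refl. Qed.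

Lemma Psi_nbhs_nbhs p U : Psi_nbhs p U -> Psi_nbhs p (Psi_nbhs^~ U).
Proof.
move=> [F finF sU]; exists F => //; case: p sU => [n|a] sU q /=.
  by move=> ->; exists F.
move=> [->|[n anF <-]]; first by exists F.
by exists F => // r /= ->; apply: sU; right; exists n.
Qed.

HB.instance Definition _ := hasNbhs.Build (Psi A) Psi_nbhs.
HB.instance Definition _ := Nbhs_isNbhsTopological.Build (Psi A)
  Psi_nbhs_filter Psi_nbhs_singleton Psi_nbhs_nbhs.

End PsiTopology.

Definition regular_closed (X : topologicalType) (C : set X) : Prop :=
  C = closure (interior C).

Definition almost_normal (X : topologicalType) : Prop :=
  forall C D : set X,
    closed C -> closed D -> regular_closed C \/ regular_closed D ->
    C `&` D = set0 ->
    exists U V : set X,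
      [/\ open U, open V, C `<=` U, D `<=` V & U `&` V = set0].

(* Main.v *)
Require Import Defs.
From mathcomp Require Import all_boot boolp classical_sets topology.
From Stdlib Require Inverse_Image.
From mathcomp Require Import functions cardinality wochoice.

(** Fix disjoint infinite sets [b n] and a set [W] such that [b n `&` W] and
    [b n `\` W] are all infinite.  By CH, the subsets of [nat] carry a
    well-order with countable initial segments.  Along it, choose infinite
    sets [f s], disjoint from [W] and almost disjoint from the [b n] and from
    the earlier [f r], such that

    - if [s] is almost disjoint from every [b n], then [f s] is almost disjoint
      from [s];
    - [f s] is split by none of the countably many separators of countable
      subfamilies of [b n], [f r] (r < s) chosen before stage [s].

    This is possible because [~` W `\` s] meets infinitely many [b n] in an
    infinite set, and this largeness is inherited by one half of any partition.
    A separator of two countable subfamilies fixed at a countable stage is a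
    partitioner for the whole family by the second clause.  By the first one no
    [s] separates the regular closed set generated by [W], which contains all
    [b n], from the closed set of the members almost disjoint from [W], which
    contains all [f s]. *)

Set Implicit Arguments.
Unset Strict Implicit.
Unset Printing Implicit Defensive.

Local Open Scope classical_set_scope.
Local Open Scope card_scope.

(** * Enumerations and well-founded recursion *)

Lemma infinite_set_natP (A : set nat) :
  infinite_set A <-> forall n, exists2 k, n <= k & A k.
Proof.
split=> [infA n|unbA].
  apply: contrapT => /forall2NP bndA; apply: infA.
  apply: (sub_finite_set _ (finite_II n)) => k Ak /=.
  by rewrite ltnNge; apply/negP; case: (bndA k).
move/finite_seqP=> [s As]; have [k] := unbA (\max_(i <- s) i).+1.
rewrite As /= => /[swap] ks; apply/negP; rewrite -leqNgt.
by apply: (@leq_bigmax_seq _ s xpredT id).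
Qed.

Lemma countable_range (T : choiceType) (x0 : T) (A : set T) :
  countable A -> exists u : nat -> T, range u = x0 |` A.
Proof.
move=> /countable_injP[f injf]; exists (fun n =>
  if n is m.+1 then xget x0 [set x | A x /\ f x = m] else x0).
apply/seteqP; split=> [_ [[|n] _ <-]|x [->|Ax]]; first by left.
- by case: xgetP => [y _ [Ay _]|_]; [right|left].
- by exists 0.
exists (f x).+1 => //; case: xgetP => [y _ [Ay fyx]|/(_ x)]; last by case.
by apply: injf => //; rewrite inE.
Qed.

(** By [loc] the condition at [s] sees only the values of [f] below [s], so the recursion may put
    [x0] elsewhere, and [ex] is needed only once all earlier stages have succeeded. *)
Lemma wf_choice (I : Type) (T : choiceType) (x0 : T) (lt : I -> I -> Prop)
    (P : (I -> T) -> I -> set T) :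
  well_founded lt ->
  (forall f g s, (forall r, lt r s -> f r = g r) -> P f s `<=` P g s) ->
  (forall f s, (forall r, lt r s -> P f r (f r)) -> P f s !=set0) ->
  exists f, forall s, P f s (f s).
Proof.
move=> wf loc ex.
pose ext s (rec : forall r, lt r s -> T) r :=
  if pselect (lt r s) is left h then rec r h else x0.
pose F s rec := xget x0 (P (@ext s rec) s).
pose f := Fix wf (fun=> T) F; exists f.
have fE s : f s = xget x0 (P (@ext s (fun r _ => f r)) s).
  rewrite /f Fix_eq // => x g h gh; congr F.
  by apply: functional_extensionality_dep => r; apply: funext => lrx.
have extE s r : lt r s -> @ext s (fun r _ => f r) r = f r.
  by rewrite /ext; case: pselect.
elim/(well_founded_ind wf) => s IH.
have [x Px] := ex f s IH; rewrite fE.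
apply: (loc (@ext s (fun r _ => f r))); first exact: extE.
apply: (xgetPex x0); exists x; apply: loc Px => r lrs.
by rewrite extE.
Qed.

(** * Well-orders with countable initial segments *)

Lemma well_order_antisymmetric_total (T : eqType) (R : rel T) :
  well_order R -> antisymmetric R /\ total R.
Proof.
move=> woR; have woRT : wo_chain R (predT : {pred T}) by move=> A _; exact: woR.
split=> x y; first exact: (wo_chain_antisymmetric woRT).
exact: (wo_chainW woRT).
Qed.

Lemma well_order_wf (T : eqType) (R : rel T) :
  well_order R -> well_founded (fun x y => R x y /\ x <> y).
Proof.
move=> woR; have [Ranti _] := well_order_antisymmetric_total woR.
move=> x; apply: contrapT => nAccx.
pose B : {pred T} := fun y => `[< ~ Acc (fun x y => R x y /\ x <> y) y >].
have [|z [[/asboolP nAccz minz] _]] := woR B; first by exists x; apply/asboolP.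
apply: nAccz; split=> y [Ryz yz]; apply: contrapT => nAccy.
by apply: yz; apply: Ranti; rewrite Ryz minz//; apply/asboolP.
Qed.

(** If a well-order of [set nat] has an uncountable initial segment, take the least [x1] that bounds
    one. By CH this segment has the size of [set nat], and an injection [g] into it pulls back an
    order with countable segments. *)
Lemma CH_order : CH -> exists lt : set nat -> set nat -> Prop,
  [/\ well_founded lt,
      forall x y z, lt x y -> lt y z -> lt x z,
      forall x y, [\/ lt x y, x = y | lt y x] &
      forall x, countable [set y | lt y x]].
Proof.
move=> ch; have [R woR] := well_ordering_principle (set nat).
pose ltR x y := R x y /\ x <> y.
have wfR : well_founded ltR := well_order_wf woR.
have [Ranti Rtotal] := well_order_antisymmetric_total woR.
have ltRN x y : ltR x y -> ~ ltR y x.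
  move=> [Rxy xy] [Ryx _]; apply: xy.
  by apply: Ranti; rewrite Rxy.
have ltRtot x y : [\/ ltR x y, x = y | ltR y x].
  have [->|/eqP xy] := eqVneq x y; first exact: Or32.
  have /orP[Rxy|Ryx] := Rtotal x y; first exact: Or31.
  by apply: Or33; split=> // /esym.
have ltR_acyclic x y z : ltR x y -> ltR y z -> ~ ltR z x.
  move: x y z; elim/(well_founded_ind wfR) => x IH y z xy yz zx.
  exact: (IH z zx x y).
have ltR_trans x y z : ltR x y -> ltR y z -> ltR x z.
  move=> xy yz; have [//|xz|/ltR_acyclic] := ltRtot x z.
    by move: xy yz; rewrite xz => /ltRN.
  by move=> /(_ _ xy)-/(_ yz).
have [[x0 x0unc]|ctb] := pselect (exists x, ~ countable [set y | ltR y x]);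
  last first.
  by exists ltR; split=> // x; apply: contrapT => ?; apply: ctb; exists x.
have [x1 [x1unc x1min]] : exists x1, ~ countable [set y | ltR y x1] /\
    forall x, ltR x x1 -> countable [set y | ltR y x].
  move: x0 x0unc; elim/(well_founded_ind wfR) => x IH xunc.
  have [[y yx yunc]|ymin] :=
    pselect (exists2 y, ltR y x & ~ countable [set z | ltR z y]).
    exact: IH yx yunc.
  exists x; split=> // y yx; apply: contrapT => yunc.
  by apply: ymin; exists y.
have [//|] := ch [set y | ltR y x1].
rewrite card_eq_le => /andP[_ /pcard_leP[g]].
have gx1 x : ltR (g x) x1 by apply: (@funS _ _ _ _ g).
have ginj : injective g by move=> x y; apply: inj; rewrite inE.
exists (fun x y => ltR (g x) (g y)); split.
- exact: Inverse_Image.wf_inverse_image.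
- by move=> x y z; exact: ltR_trans.
- move=> x y; case: (ltRtot (g x) (g y)) => [|/ginj|].
  + exact: Or31.
  + exact: Or32.
  + exact: Or33.
move=> x; rewrite -(eq_countable (inj_card_eq (f := g) (in2W ginj))).
apply: sub_countable (x1min _ (gx1 x)).
by apply: subset_card_le => _ [y yx <-].
Qed.

(** * Separation inside a countable family *)

Lemma countable_setU (T : Type) (A B : set T) :
  countable A -> countable B -> countable (A `|` B).
Proof.
move=> cA cB; rewrite -bigcup2E.
by apply: bigcup_countable => // -[|[|n]] _.
Qed.

(** Enumerate [A] and let [D] collect the members in [B], each stripped of the earlier members
    outside [B]. A member in [B] loses finitely many finite intersections; a member outside [B]
    meets only pieces of index at most its own. *)
Lemma exists_separator (A B : set (set nat)) :
  countable A -> almost_disjoint_family A ->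
  exists D : set nat, forall a, A a ->
    if `[< B a >] then a `<=*` D else finite_set (a `&` D).
Proof.
move=> cA [_ adA]; have [u uA] := countable_range set0 cA.
pose D := \bigcup_(n in [set n | A (u n) /\ B (u n)])
  (u n `\` \bigcup_(m in [set m | [/\ m < n, A (u m) & ~ B (u m)]]) u m).
exists D => a Aa; have [n _ una] : range u a by rewrite uA; right.
subst a; case: asboolP => Bun.
  apply: (@sub_finite_set _ _
    (\bigcup_(m in [set m | [/\ m < n, A (u m) & ~ B (u m)]]) (u n `&` u m))).
    move=> k [unk nDk]; apply: contrapT => nk; apply: nDk.
    exists n => //; split=> // -[m mn umk]; apply: nk.
    by exists m.
  apply: bigcup_finite; first by apply: sub_finite_set (finite_II n) => m [].
  by move=> m [_ Aum nBum]; apply: adA => // unm; apply: nBum; rewrite -unm.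
apply: (@sub_finite_set _ _
  (\bigcup_(m in [set m | [/\ m <= n, A (u m) & B (u m)]]) (u n `&` u m))).
  move=> k [unk [m [Aum Bum] [umk nk]]]; exists m => //; split=> //.
  by rewrite leqNgt; apply/negP => nm; apply: nk; exists n.
apply: bigcup_finite; first by apply: sub_finite_set (finite_II n.+1) => m [].
by move=> m [_ Aum Bum]; apply: adA => // unm; apply: Bun; rewrite unm.
Qed.

(** * Large sets and their generic subsets *)

Section Large.
Variable b : nat -> set nat.

(** Positivity for the ideal of the sets that meet all but finitely many [b n] in a finite set. *)
Definition large (Y : set nat) :=
  forall N, exists2 n, N <= n & infinite_set (Y `&` b n).

Lemma large_infinite Y : large Y -> infinite_set Y.
Proof.
by move=> /(_ 0)[n _]; apply: sub_infinite_set => k [].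
Qed.

Lemma largeD Y X : large Y ->
  (exists N, forall n, N <= n -> finite_set (X `&` b n)) -> large (Y `\` X).
Proof.
move=> lY [M XM] N; have [n] := lY (maxn N M).
rewrite geq_max => /andP[Nn Mn] infY; exists n => // finYX; apply: infY.
apply: (@sub_finite_set _ _ ((Y `\` X) `&` b n `|` X `&` b n)).
  by move=> k [Yk bk]; have [Xk|nXk] := pselect (X k); [right|left].
by rewrite finite_setU; split=> //; apply: XM.
Qed.

Lemma large_split Y P : large Y -> ~ large (Y `&` P) -> large (Y `\` P).
Proof.
move=> lY /existsNP[M /forall2NP YPM].
rewrite -(set0U (_ `\` _)) -(setDv Y) -setDIr.
apply: largeD => //; exists M => n Mn.
by case: (YPM n) => // /contrapT.
Qed.

(* [x] is a pseudo-intersection of a decreasing sequence of large sets that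
   avoids each member of [X] and decides each member of [Q] in turn. *)
Lemma exists_generic (X Q : set (set nat)) (Y : set nat) :
  countable X -> countable Q ->
  (forall x, X x -> exists N, forall n, N <= n -> finite_set (x `&` b n)) ->
  large Y ->
  exists x, [/\ infinite_set x, x `<=` Y,
    forall y, X y -> finite_set (x `&` y) &
    forall q, Q q -> x `<=*` q \/ finite_set (x `&` q)].
Proof.
move=> cX cQ Xb lY.
have [u uX] := countable_range set0 cX; have [q qQ] := countable_range set0 cQ.
pose next n Z := let Z' := Z `\` u n in
  if `[< large (Z' `&` q n) >] then Z' `&` q n else Z' `\` q n.
pose S := fix S n := if n is m.+1 then next m (S m) else Y.
have lS n : large (S n).
  elim: n => //= n IH; rewrite /next.
  have lD : large (S n `\` u n).
    apply: largeD => //; have : range u (u n) by [].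
    rewrite uX => -[->|/Xb//].
    by exists 0 => m _; rewrite set0I; exact: finite_set0.
  by case: asboolP => // /large_split-/(_ lD).
have Ssub m n : m <= n -> S n `<=` S m.
  move/subnK <-; elim: (n - m) => //= k IH; apply: subset_trans IH.
  by rewrite /next; case: asboolP => _ j [[]].
have /choice[e eP] n : exists k, n <= k /\ S n k.
  by have /infinite_set_natP/(_ n)[k nk Sk] := large_infinite (lS n); exists k.
have eS n : finite_set (range e `\` S n).
  apply: (@sub_finite_set _ _ (e @` `I_n)); last exact/finite_image/finite_II.
  move=> _ [[m _ <-] nSe]; exists m => //=; rewrite ltnNge; apply/negP => nm.
  by apply: nSe; apply: Ssub nm _ _; have [] := eP m.
exists (range e); split.
- apply/infinite_set_natP => n; exists (e n); last by exists n.
  by have [] := eP n.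
- by move=> _ [n _ <-]; apply: (Ssub 0 n) => //; have [] := eP n.
- move=> y Xy; have [n _ <-] : range u y by rewrite uX; right.
  apply: sub_finite_set (eS n.+1) => k [ek uk]; split=> //=.
  by rewrite /next; case: asboolP => _ [[_ /(_ uk)]].
- move=> p Qp; have [n _ <-] : range q p by rewrite qQ; right.
  have [lq|nlq] := pselect (large ((S n `\` u n) `&` q n)); [left|right].
    apply: sub_finite_set (eS n.+1) => k [ek nqk]; split=> //=.
    by rewrite /next asboolT// => -[].
  apply: sub_finite_set (eS n.+1) => k [ek qk]; split=> //=.
  by rewrite /next asboolF// => -[].
Qed.

End Large.

(** * Columns, and coding by subsets of [nat] *)

Lemma exists_split_columns : exists (b : nat -> set nat) (W : set nat),
  [/\ forall n m, n <> m -> b n `&` b m = set0,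
      forall n, infinite_set (b n `&` W) &
      forall n, infinite_set (b n `\` W)].
Proof.
(* Column [n] will hold the numbers whose half codes a pair with first entry [n]; parity, which
   halving forgets, is left for [W]. Halves that code no pair go to column 0. *)
pose c k := (odflt (0, 0) (choice.unpickle k)).1.
pose e (n k : nat) := choice.pickle (n, k).
have ce n k : c (e n k) = n by rewrite /c /e choice.pickleK.
have einj n : injective (e n).
  by move=> k l /(pcan_inj choice.pickleK)[].
have infI (f : nat -> nat) : injective f -> infinite_set (range f).
  move=> finj; rewrite (eq_finite_set (inj_card_eq (in2W finj))).
  exact: infinite_nat.
exists (fun n => [set k | c k./2 = n]), [set k | odd k]; split.
- move=> n m nm; apply/seteqP; split=> // k [/= kn km].
  by apply: nm; rewrite -kn.
- move=> n; apply: sub_infinite_set (infI (fun k => (e n k).*2.+1) _).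
    by move=> _ [k _ <-]; split=> /=; rewrite ?uphalf_double ?ce ?odd_double.
  by move=> k l [] /double_inj/einj.
- move=> n; apply: sub_infinite_set (infI (fun k => (e n k).*2) _).
    by move=> _ [k _ <-]; split=> /=; rewrite ?doubleK ?ce ?odd_double.
  by move=> k l /double_inj/einj.
Qed.

(** One fixed choice, so that the stages of the recursion and the final proof speak of the same
    set. *)
Definition separator (A B : set (set nat)) : set nat :=
  xget set0 [set D | forall a, A a ->
    if `[< B a >] then a `<=*` D else finite_set (a `&` D)].

Lemma separatorP (A B : set (set nat)) :
  countable A -> almost_disjoint_family A -> forall a, A a ->
  if `[< B a >] then a `<=*` separator A B
  else finite_set (a `&` separator A B).
Proof.
by move=> cA adA; exact: (xgetPex set0 (exists_separator B cA adA)).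
Qed.

(* Codes a nonempty countable family of subsets of [nat] by one subset. *)
Definition sections (r : set nat) : set (set nat) :=
  range (fun n : nat => [set m : nat | r (choice.pickle (n, m))]).

Lemma exists_sections (B : set (set nat)) :
  countable B -> exists r, sections r = set0 |` B.
Proof.
move=> cB; have [u uB] := countable_range set0 cB.
exists [set k | if choice.unpickle k is Some (n, m) then u n m else False].
rewrite /sections -uB; apply: eq_imagel => n _.
by apply/seteqP; split=> m /=; rewrite choice.pickleK.
Qed.

(** * The recursive construction and strong separation *)

Section Construction.
Variables (b : nat -> set nat) (W : set nat).
Variable lt : set nat -> set nat -> Prop.
Hypothesis b_infinite : forall n, infinite_set (b n).
Hypothesis b_disjoint : forall n m, n <> m -> b n `&` b m = set0.
Hypothesis b_W : forall n, infinite_set (b n `\` W).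
Hypothesis lt_wf : well_founded lt.
Hypothesis lt_trans : forall x y z, lt x y -> lt y z -> lt x z.
Hypothesis lt_total : forall x y, [\/ lt x y, x = y | lt y x].
Hypothesis lt_countable : forall x, countable [set y | lt y x].

Definition upto (f : set nat -> set nat) (t : set nat) : set (set nat) :=
  range b `|` f @` [set r | r = t \/ lt r t].

(** Here [s] is both the stage and a candidate separator to defeat. A pair of [r] and [t] below [s]
    is a task: separating, in [upto f t], the members coded by [r] from the others. *)
Definition spec (f : set nat -> set nat) (s : set nat) : set (set nat) :=
  [set x | [/\ infinite_set x, x `<=` ~` W,
    (forall n, finite_set (s `&` b n)) -> finite_set (x `&` s),
    (forall n, finite_set (x `&` b n)) /\
      (forall r, lt r s -> finite_set (x `&` f r)) &
    forall r t, lt r s -> lt t s ->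
      x `<=*` separator (upto f t) (sections r) \/
      finite_set (x `&` separator (upto f t) (sections r))]].

Lemma spec_local f g s : (forall r, lt r s -> f r = g r) ->
  spec f s `<=` spec g s.
Proof.
move=> fg x [infx xW xs [xb xf] xq]; split=> //.
  by split=> // r rs; rewrite -fg//; exact: xf.
move=> r t rs ts; suff <- : upto f t = upto g t by exact: xq.
rewrite /upto; congr (_ `|` _); apply: eq_imagel => q [->|qt]; apply: fg => //.
exact: lt_trans qt ts.
Qed.

Lemma spec_nonempty f s : (forall r, lt r s -> spec f r (f r)) ->
  spec f s !=set0.
Proof.
move=> IH.
have cX : countable (range b `|` f @` [set r | lt r s]).
  apply: countable_setU.
    by apply: sub_countable (card_image_le _ _) _.
  exact: sub_countable (card_image_le _ _) (lt_countable s).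
pose Q := (fun p => separator (upto f p.2) (sections p.1)) @`
  ([set r | lt r s] `*` [set r | lt r s]).
have cQ : countable Q.
  apply: sub_countable (card_image_le _ _) _.
  exact: countableX.
pose Y := if `[< forall n, finite_set (s `&` b n) >] then ~` W `\` s else ~` W.
have lW : large b (~` W).
  by move=> N; exists N => //; rewrite setIC -setDE.
have lY : large b Y.
  rewrite /Y; case: asboolP => // sb; apply: largeD => //.
  by exists 0.
have [|x [infx xY xX xQ]] := exists_generic cX cQ _ lY.
  move=> _ [[m _ <-]|[r rs <-]].
    (* Each [b m] is disjoint from all later columns, hence the bound [m.+1]; an earlier [f r] meets
       every column finitely, hence the bound 0 below. *)
    exists m.+1 => n mn; rewrite b_disjoint ?finite_set0// => nm.
    by rewrite nm ltnn in mn.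
  by exists 0 => n _; have [_ _ _ [fb _] _] := IH r rs.
exists x; split=> //.
- by move=> k /xY; rewrite /Y; case: asboolP => // _ [].
- move=> sb; have -> : x `&` s = set0; last exact: finite_set0.
  by apply/seteqP; split=> // k [/xY]; rewrite /Y asboolT// => -[].
- split=> [n|r rs]; apply: xX; first by left; exists n.
  by right; exists r.
by move=> r t rs ts; apply: xQ; exists (r, t).
Qed.

Lemma exists_spec : exists f, forall s, spec f s (f s).
Proof. exact: wf_choice lt_wf spec_local spec_nonempty. Qed.

Variable f : set nat -> set nat.
Hypothesis fP : forall s, spec f s (f s).
Let A : set (set nat) := range b `|` range f.

Lemma family_almost_disjoint : almost_disjoint_family A.
Proof.
split=> [_ [[n _ <-]|[s _ <-]]|]; first exact: b_infinite.
  by have [] := fP s.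
have fb s n : finite_set (f s `&` b n) by have [_ _ _ []] := fP s.
move=> _ _ [[n _ <-]|[s _ <-]] [[m _ <-]|[t _ <-]] neq.
- rewrite b_disjoint ?finite_set0// => nm; apply: neq; congr b; exact: nm.
- by rewrite setIC.
- by [].
- have [st|st|ts] := lt_total s t.
  + by rewrite setIC; have [_ _ _ [_ +] _] := fP t; apply.
  + by rewrite st in neq.
  + by have [_ _ _ [_ +] _] := fP s; apply.
Qed.

(** Cantor's diagonal: an enumeration of [K] and of all predecessors of its elements misses some
    set, which by totality lies above [K]. *)
Lemma lt_unbounded (K : set (set nat)) :
  countable K -> exists t, forall k, K k -> lt k t.
Proof.
move=> cK.
have cKlt : countable (K `|` \bigcup_(k in K) [set y | lt y k]).
  by apply: countable_setU => //; exact: bigcup_countable.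
have [u uP] := countable_range set0 cKlt.
exists [set n | ~ u n n] => k Kk.
suff nK : ~ (range u) [set n | ~ u n n].
  have [//|kt|tk] := lt_total k [set n | ~ u n n]; case: nK; rewrite uP; right.
    by left; rewrite -kt.
  by right; exists k.
move=> [n _ un]; have unn : u n n = ~ u n n by rewrite {1}un.
have nunn : ~ u n n by move=> h; have := h; rewrite unn.
by apply: (nunn); rewrite unn.
Qed.

Lemma upto_sub t : upto f t `<=` A.
Proof. by move=> a [ba|[r _ <-]]; [left|right; exists r]. Qed.

Lemma countable_upto t : countable (upto f t).
Proof.
apply: countable_setU.
  by apply: sub_countable (card_image_le _ _) _.
apply: sub_countable (card_image_le _ _) _.
apply: (@sub_countable _ _ _ ([set t] `|` [set r | lt r t])).
  by apply: subset_card_le => r [->|]; [left|right].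
by apply: countable_setU; [exact: countable1|exact: lt_countable].
Qed.

Lemma sub_upto B : B `<=` A -> countable B ->
  exists t0, forall t, lt t0 t -> B `<=` upto f t.
Proof.
(* For [a] in [B] that is not a column, [i a] is a stage whose value is [a]; beyond a bound of these
   stages all of [B] is present. *)
move=> BA cB; have /choice[i iP] :
    forall a, exists r, B a -> ~ (range b) a -> f r = a.
  move=> a; have [[r fra]|nex] := pselect (exists r, f r = a).
    by exists r.
  by exists set0 => /BA[//|[r _ fra]]; case: nex; exists r.
have [|t0 t0P] := @lt_unbounded (i @` B).
  exact: sub_countable (card_image_le _ _) cB.
exists t0 => t t0t a Ba; have [ba|nba] := pselect ((range b) a); first by left.
right; exists (i a); last exact: iP.
by right; apply: lt_trans t0t; apply: t0P; exists a.
Qed.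

Lemma family_almost_disjoint_upto t : almost_disjoint_family (upto f t).
Proof.
have [Ainf Aad] := family_almost_disjoint.
split=> [a /upto_sub|a a' /upto_sub Aa /upto_sub]; first exact: Ainf.
exact: Aad.
Qed.

Lemma family_separated : strongly_aleph0_separated A.
Proof.
(* A partitioner must be infinite, so [B] is made nonempty by adding some [f t'] outside [C]. *)
suff sep B C : B `<=` A -> C `<=` A -> countable B -> countable C ->
    B `&` C = set0 -> B !=set0 ->
    exists D, [/\ partitioner A D, forall b, B b -> b `<=*` D &
                  forall c, C c -> finite_set (c `&` D)].
  move=> B C BA CA cB cC BC.
  have [t0 Ct0] := sub_upto CA cC.
  have [t t0t] : exists t, lt t0 t.
    by have [t tP] := lt_unbounded (countable1 t0); exists t; apply: tP.
  have [t' tt'] : exists t', lt t t'.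
    by have [t' t'P] := lt_unbounded (countable1 t); exists t'; apply: t'P.
  have nC : ~ C (f t').
    move=> /(Ct0 t t0t) ut.
    have [inff _ _ [fb fr] _] := fP t'; apply: inff.
    rewrite -[X in finite_set X]setIid.
    case: ut => [[n _ {2}<-]|[r rt {2}<-]]; first exact: fb.
    by apply: fr; case: rt => [->//|rt]; exact: lt_trans tt'.
  have [||||D [pD BD CD]] := sep (B `|` [set f t']) C _ CA _ cC _ _.
  - by move=> a [/BA//|->]; right; exists t'.
  - by apply: countable_setU => //; exact: countable1.
  - by rewrite setIUl BC set0U; apply/seteqP; split=> // a [-> /nC].
  - by exists (f t'); right.
  - by exists D; split=> // a Ba; apply: BD; left.
move=> BA CA cB cC BC [a0 Ba0].
have [r rB] := exists_sections cB.
have [t1 BCt1] : exists t0, forall t, lt t0 t -> B `|` C `<=` upto f t.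
  apply: sub_upto; first by move=> a [/BA|/CA].
  exact: countable_setU.
(* With [t] above the code [r], the last clause of [spec] makes every [f s] with [s] above [t]
   decide [D]; with [t] above [t1], the separator handles all of [B] and [C]. *)
have [t tP] : exists t, lt r t /\ lt t1 t.
  have [|t tP] := @lt_unbounded ([set r] `|` [set t1]).
    by apply: countable_setU; exact: countable1.
  by exists t; split; apply: tP; [left|right].
have [rt t1t] := tP.
pose D := separator (upto f t) (sections r).
have DP := separatorP (sections r) (countable_upto t)
  (family_almost_disjoint_upto t).
have infA a : A a -> infinite_set a.
  by have [+ _] := family_almost_disjoint; apply.
have BD a : B a -> a `<=*` D.
  move=> Ba; have := DP a; rewrite asboolT; last by rewrite rB; right.
  by apply; apply: (BCt1 t t1t); left.
exists D; split=> //; last first.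
  move=> c Cc; have := DP c; rewrite asboolF.
    by apply; apply: (BCt1 t t1t); right.
  (* The padding [set0] in [sections r] is not a member of [A]. *)
  rewrite rB => -[c0|Bc].
    by apply: (infA c (CA c Cc)); rewrite c0; exact: finite_set0.
  by have : (B `&` C) c by []; rewrite BC.
split=> [finD|a Aa].
  apply: (infA a0 (BA a0 Ba0)).
  apply: (@sub_finite_set _ _ ((a0 `\` D) `|` D)).
    by move=> k a0k; have [Dk|nDk] := pselect (D k); [right|left].
  by rewrite finite_setU; split=> //; exact: BD.
have [ut|nut] := pselect (upto f t a).
  by have := DP a ut; case: asboolP; [left|right].
case: Aa nut => [ba|[s _ <-]] nut; first by case: nut; left.
have [st|st|ts] := lt_total s t.
- by case: nut; right; exists s => //; right.
- by case: nut; right; exists s => //; left.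
- have [_ _ _ _] := fP s; apply => //; exact: lt_trans ts.
Qed.

End Construction.

(** * Failure of almost-normality *)

Lemma Psi_nat_closure (A : set (set nat)) (W : set nat) (a : A) :
  closure (@Psi_nat A @` W) (Psi_mem a) <-> infinite_set (val a `&` W).
Proof.
split=> [clW finaW|infaW U [F finF FU]].
  have [|p [[n Wn <-]]] := clW (Psi_basic (Psi_mem a) (val a `&` W)).
    by exists (val a `&` W).
  by move=> [//|[m [am nm] []] mn]; apply: nm; rewrite mn in am *.
have [n [[an Wn] nF]] : ((val a `&` W) `\` F) !=set0.
  by apply/infinite_setN0/infinite_setD.
exists (Psi_nat A n); split; first by exists n.
by apply: FU; right; exists n.
Qed.

(** The closure of [W] is regular closed, as points of [nat] are isolated, and it contains the
    members that meet [W] infinitely. The other members form a closed set [D]. The trace on [nat] of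
    an open set around [D], in a separation of the two, would be an [S] that the hypothesis
    excludes. *)
Lemma not_almost_normal (A : set (set nat)) (W : set nat) :
  (forall S : set nat,
    (forall a, A a -> infinite_set (a `&` W) -> finite_set (a `&` S)) ->
    exists2 a, A a /\ finite_set (a `&` W) & ~ a `<=*` S) ->
  ~ almost_normal (Psi A).
Proof.
move=> nsep nor.
pose C := closure (@Psi_nat A @` W).
pose D : set (Psi A) :=
  [set p | if p is inr a then finite_set (val a `&` W) else False].
have [||||U [V [oU oV CU DV UV]]] := nor C D.
- exact: closed_closure.
- rewrite -openC openE => -[n|a] nD.
    by exists set0; [exact: finite_set0|move=> _ ->].
  by exists set0; [exact: finite_set0|move=> _ [->//|[n _ <-]]].
- left; apply/seteqP; split.
    apply: closureS => _ [n Wn <-].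
    exists set0; first exact: finite_set0.
    by move=> _ ->; apply: subset_closure; exists n.
  apply: subset_trans (closureS (@interior_subset _ C)) _.
  by rewrite -(closure_id C).1//; exact: closed_closure.
- apply/seteqP; split=> // -[n|a] [Cp Dp] //.
  exact: (Psi_nat_closure W a).1 Cp Dp.
have [a Aa infaW|a [Aa finaW] naV] := nsep [set n | V (Psi_nat A n)].
  pose a' : A := SigSub (mem_set Aa).
  have Ua : U (Psi_mem a') by apply: CU; apply/Psi_nat_closure.
  move: oU; rewrite openE => /(_ _ Ua)[F finF FU].
  apply: sub_finite_set finF => n [an Vn]; apply: contrapT => nF.
  suff : (U `&` V) (Psi_nat A n) by rewrite UV.
  by split=> //; apply: FU; right; exists n.
pose a' : A := SigSub (mem_set Aa).
have Va : V (Psi_mem a') by apply: DV.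
move: oV; rewrite openE => /(_ _ Va)[F finF FV].
apply: naV; apply: sub_finite_set finF => n [an nV]; apply: contrapT => nF.
by apply: nV; apply: FV; right; exists n.
Qed.

Theorem theorem5p1 :
  CH ->
  exists A : set (set nat),
    [/\ almost_disjoint_family A,
        strongly_aleph0_separated A &
        ~ almost_normal (Psi A)].
Proof.
move=> /CH_order[lt [wf tr tot ctbl]].
have [b [W [bdisj bW bNW]]] := exists_split_columns.
have binf n : infinite_set (b n).
  by apply: sub_infinite_set (bW n) => k [].
have [f fP] := exists_spec bdisj bNW wf tr ctbl.
exists (range b `|` range f); split.
- exact: (family_almost_disjoint binf bdisj tot fP).
- exact: (family_separated binf bdisj tr tot ctbl fP).
apply: (@not_almost_normal _ W) => S bS.
have [inff fW fS _ _] := fP S.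
(* The stage indexed by [S] defeats it: each [b n] meets [W] infinitely, so [S] is almost disjoint
   from every [b n], and hence [f S] from [S]. *)
exists (f S).
  split; first by right; exists S.
  suff -> : f S `&` W = set0 by exact: finite_set0.
  by apply/seteqP; split=> // k [/fW].
move=> fsubS; apply: inff.
apply: (@sub_finite_set _ _ ((f S `\` S) `|` (f S `&` S))).
  by move=> k fk; have [Sk|nSk] := pselect (S k); [right|left].
rewrite finite_setU; split=> //; apply: fS => n; rewrite setIC.
by apply: bS; [left; exists n|exact: bW].
Qed.
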